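(* For each real $\alpha>1$ let $$\mathbb{T}_\alpha:=\{\omega=\omega_1\omega_2\cdots\in\mathbb{N}^{\mathbb{N}} : \omega_1+\cdots+\omega_n<n\alpha\ \text{for each } n\in\mathbb{N}\},\qquad \pi(\mathbb{T}_\alpha)=\{[0;\omega_1,\omega_2,\ldots] : \omega\in\mathbb{T}_\alpha\},$$ and $$X_\alpha:=\Big\{[0;\omega_1,\omega_2,\ldots] : \omega=\omega_1\omega_2\cdots\in\mathbb{N}^{\mathbb{N}},\ \limsup_{n\to\infty}\frac1n\sum_{i=1}^n\omega_i<\alpha\Big\}.$$ Then $\dim_{\mathcal{H}}X_\alpha=\dim_{\mathcal{H}}\pi(\mathbb{T}_\alpha)$ for each $\alpha>1$, and $\dim_{\mathcal{H}}X_\alpha\ (=\dim_{\mathcal{H}}\pi(\mathbb{T}_\alpha))$ converges to $1$ as $\alpha$ tends to infinity.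
   Context: $\mathbb{N}$ is the set of positive integers. For $\omega=\omega_1\omega_2\cdots\in\mathbb{N}^{\mathbb{N}}$, $$[0;\omega_1,\omega_2,\ldots]:=\cfrac{1}{\omega_1+\cfrac{1}{\omega_2+\cdots}}$$ denotes the value of the infinite regular continued fraction, regarded as a point of $X:=\{z\in\mathbb{C} : |z-1/2|\le1/2\}$. $\dim_{\mathcal{H}}A$ denotes the Hausdorff dimension of $A\subset\mathbb{C}$ (Euclidean metric). The set $\pi(\mathbb{T}_\alpha)$ is the limit set generated by the maps $\phi_b\colon X\to X$, $\phi_b(z)=1/(z+b)$ ($b\in\mathbb{N}$), along the set $\mathbb{T}_\alpha$ of infinite words, i.e. the set of continued fractions displayed in the claim. *)

(* Defs.v *)
From mathcomp Require Import all_boot all_order all_algebra.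
From mathcomp Require Import complex.
From mathcomp Require Import all_classical all_reals all_analysis.

Set Implicit Arguments.
Unset Strict Implicit.
Unset Printing Implicit Defensive.

Import Order.TTheory GRing.Theory Num.Theory.
Import numFieldNormedType.Exports.

Local Open Scope classical_set_scope.
Local Open Scope ring_scope.
Local Open Scope complex_scope.

Section Hausdorff.
Variable R : realType.
Implicit Types (A U : set R[i]) (s delta : R).

(* The MathComp modulus is valued in [R[i]]; its real part is the real modulus.
   The diameter of the empty set comes out as [-oo]. *)
Definition diam U : \bar R :=
  ereal_sup [set (complex.Re `|x - y|)%:E | x in U & y in U].

(* The empty set has weight 0 for every [s], including [s = 0]. *)
Definition diam_pow s U : \bar R :=
  if `[< U = set0 >] then 0%E else poweR (diam U) s.

Definition hausdorff_premeasure s delta A : \bar R :=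
  ereal_inf [set (\sum_(0 <= i <oo) diam_pow s (U i))%E |
    U in [set U : nat -> set R[i] |
      A `<=` \bigcup_i U i /\ forall i, (diam (U i) <= delta%:E)%E]].

(* The premeasure is nonincreasing in [delta], so the limit as [delta] tends
   to 0 is a supremum. *)
Definition hausdorff_measure s A : \bar R :=
  ereal_sup [set hausdorff_premeasure s delta A | delta in [set d : R | 0 < d]].

Definition hausdorff_dim A : \bar R :=
  ereal_inf [set s%:E | s in [set s : R | 0 <= s /\ hausdorff_measure s A = 0%E]].

End Hausdorff.

(* A word [omega_1 omega_2 ...] over the positive integers is encoded by
   [w : nat -> nat] with [w i = omega_(i+1)] and all letters positive. *)
Definition positive_word (w : nat -> nat) : Prop := forall i, (0 < w i)%N.

Section ContinuedFractions.
Variable R : realType.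
Implicit Types (w : nat -> nat) (alpha : R).

(* [convergent w n = [0; omega_1, ..., omega_n]] *)
Fixpoint convergent w (n : nat) : R :=
  if n is m.+1 then ((w 0%N)%:R + convergent (fun i => w i.+1) m)^-1 else 0.

Definition cfrac w : R[i] := (limn (convergent w))%:C.

Definition T_words alpha : set (nat -> nat) :=
  [set w | positive_word w /\
    forall n, (0 < n)%N -> (\sum_(i < n) w i)%N%:R < n%:R * alpha].

Definition piT alpha : set R[i] := cfrac @` T_words alpha.

Definition X_set alpha : set R[i] :=
  cfrac @` [set w | positive_word w /\
    (limn_esup (fun n => ((\sum_(i < n.+1) w i)%N%:R / n.+1%:R)%:E)
       < alpha%:E)%E].

End ContinuedFractions.

(* Main.v *)
Require Import Defs.
From mathcomp Require Import all_boot all_order all_algebra.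
From mathcomp Require Import complex ring lra zify.
From mathcomp Require Import all_classical all_reals all_analysis.

Import Order.TTheory GRing.Theory Num.Theory.
Import numFieldNormedType.Exports.

Local Open Scope classical_set_scope.
Local Open Scope ring_scope.

(** Write [lam u] for the size (up to a factor 4) of the cylinder of continued
    fractions that begin with the finite word [u]; by bounded distortion
    [lam u * lam v <= lam (u ++ v)].

    The words all of whose prefixes have average less than [alpha] form a
    monoid under concatenation, and its members of length [n] are finite in
    number. Fix [s > 0] and consider the sum of [lam u ^ s] over the
    admissible words [u] of length [n]. There are two cases.

    - If the sum is at least 1 for some [n], the infinite concatenations of
      these words carry a mass distribution in which a cylinder [v] has mass
      at most a constant times [lam v ^ s]. Since the letters are bounded, a
      set that meets two cylinders branching at [v] has diameter at least a
      constant times [lam v]; hence the set of these continued fractions is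
      not null for the [s]-dimensional content
      ([not_content_null_of_block_seqs]). Each block has an integer sum
      less than [n * alpha], and there are finitely many blocks, so the
      upper average of every concatenation is strictly below [alpha] and
      [X_set alpha] has dimension at least [s].

    - If the sum is less than 1 for every [n], the cylinders of length [n]
      are covers of [piT alpha] that show that its dimension is at most [s]
      ([piT_content_null]).

    Therefore the dimension of [piT alpha] is at most that of [X_set alpha].
    Conversely, a word with upper average below [alpha] belongs to [T_words]
    after enough letters 1 are put in front of it, so [X_set alpha] is covered
    by countably many bi-Lipschitz preimages of [piT alpha]
    ([content_null_X_set]).

    For the limit, let [0 < s < 1]. The cylinders of length [n] with letters
    at most [N] have total length close to 1 if [N] is much larger than [n],
    while each of them has length at most [1 / n]; hence the sum of
    [lam u ^ s] over them is at least 1 for suitable [n] and [N]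
    ([sum_lam_words]). All these words are admissible when [alpha > N], so
    the first case gives dimension at least [s]. The dimension is at most 1
    because the sets lie in a segment.

    Hausdorff measure enters only through its null sets, which are the null
    sets of the unrestricted content ([hausdorff_measure0P]). The mass
    distribution principle is used in a combinatorial form
    ([cylinder_cover_mass]): cylinders that cover the whole tree have total
    mass at least 1. *)

Set Implicit Arguments.
Unset Strict Implicit.
Unset Printing Implicit Defensive.

(** * Null sets for the Hausdorff content *)

Section Hausdorff.
Variable R : realType.
Implicit Types (A B U V : set R[i]) (s : R) (z : R[i]).

Definition cdist z z' : R := complex.Re `|z - z'|.

Lemma cdist_ge0 z z' : 0 <= cdist z z'.
Proof. by rewrite /cdist normc_def/= sqrtr_ge0. Qed.

Lemma cdist_real (x y : R) : cdist x%:C%C y%:C%C = `|x - y|.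
Proof. by rewrite /cdist normc_def/= subrr expr0n/= addr0 sqrtr_sqr. Qed.

Lemma diam_pow_ge0 s U : (0 <= diam_pow s U)%E.
Proof. by rewrite /diam_pow; case: ifP => // _; exact: poweR_ge0. Qed.

Lemma diam_pow_set0 s : diam_pow s (set0 : set R[i]) = 0%E.
Proof. by rewrite /diam_pow asboolT. Qed.

Lemma diam_powE s U z : U z -> diam_pow s U = poweR (diam U) s.
Proof. by rewrite /diam_pow => Uz; case: asboolP => // U0; rewrite U0 in Uz. Qed.

Lemma diam_ubound U z z' : U z -> U z' -> ((cdist z z')%:E <= diam U)%E.
Proof. by move=> Uz Uz'; apply: ereal_sup_ubound; exists z => //; exists z'. Qed.

Lemma diam_ge0 U z : U z -> (0 <= diam U)%E.
Proof.
by move=> Uz; apply: le_trans (diam_ubound Uz Uz); rewrite lee_fin cdist_ge0.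
Qed.

Lemma diam_le U (b : \bar R) :
  (forall z z', U z -> U z' -> ((cdist z z')%:E <= b)%E) -> (diam U <= b)%E.
Proof.
by move=> h; apply: ge_ereal_sup => _ [z Uz [z' Uz' <-]]; exact: h.
Qed.

Lemma poweR_mono s (a b : \bar R) : 0 <= s -> (0 <= a)%E -> (a <= b)%E ->
  (poweR a s <= poweR b s)%E.
Proof.
by move=> s0 a0 ab; apply: gt0_ler_poweR; rewrite ?in_itv//= ?leey ?andbT// (le_trans a0).
Qed.

Lemma diam_pow_le s U (r : R) : 0 <= s -> 0 <= r ->
  (forall z z', U z -> U z' -> cdist z z' <= r) -> (diam_pow s U <= (r `^ s)%:E)%E.
Proof.
move=> s0 r0 h; have [->|/set0P[z Uz]] := eqVneq U set0.
  by rewrite diam_pow_set0 lee_fin powR_ge0.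
rewrite (diam_powE _ Uz) -poweR_EFin; apply: poweR_mono => //.
  exact: diam_ge0 Uz.
by apply: diam_le => x y Ux Uy; rewrite lee_fin h.
Qed.

Lemma diam_pow_ge s U z z' : 0 <= s -> U z -> U z' ->
  ((cdist z z' `^ s)%:E <= diam_pow s U)%E.
Proof.
move=> s0 Uz Uz'; rewrite (diam_powE _ Uz) -poweR_EFin.
by apply: poweR_mono => //; [rewrite lee_fin cdist_ge0|exact: diam_ubound].
Qed.

(** The [s]-dimensional Hausdorff content is zero. There is no bound on the
    diameters of the covering sets, which makes covers easier to transport. *)
Definition content_null s A := forall e : R, 0 < e ->
  exists2 U : nat -> set R[i], A `<=` \bigcup_i U i &
    (\sum_(0 <= i <oo) diam_pow s (U i) <= e%:E)%E.

Lemma diam_pow_le_series s (U : nat -> set R[i]) i (b : \bar R) :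
  (\sum_(0 <= i <oo) diam_pow s (U i) <= b)%E -> (diam_pow s (U i) <= b)%E.
Proof.
apply: le_trans; apply: le_trans (nneseries_lim_ge i.+1 _) => [|n _ _]; last exact: diam_pow_ge0.
rewrite big_nat_recr//= leeDr// sume_ge0// => k _; exact: diam_pow_ge0.
Qed.

(** A cover of small total weight consists of sets of small diameter, because
    each weight is at most the total. For [s = 0] a weight below 1 even forces
    the set to be empty. *)
Lemma hausdorff_measure0P s A : 0 <= s ->
  hausdorff_measure s A = 0%E <-> content_null s A.
Proof.
move=> s0; split=> [H0 e e0|nA].
  have : (hausdorff_premeasure s 1 A < e%:E)%E.
    apply: (@le_lt_trans _ _ 0%E); last by rewrite lte_fin.
    by rewrite -H0; apply: ereal_sup_ubound; exists 1 => //=.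
  by move=> /ereal_inf_lt[_ [U [AU _] <-] /ltW]; exists U.
apply/eqP; rewrite eq_le; apply/andP; split.
  apply: ge_ereal_sup => _ [d d0 <-]; apply/lee_addgt0Pr => e e0; rewrite add0e.
  have [sp|s_le0] := ltP 0 s.
    have ds0 : 0 < d `^ s by exact: powR_gt0.
    have [|U AU Ue] := nA (Num.min e (d `^ s)); first by rewrite lt_min e0.
    apply: ge_ereal_inf; exists (\sum_(0 <= i <oo) diam_pow s (U i))%E; last first.
      by apply: le_trans Ue _; rewrite lee_fin ge_min lexx.
    exists U => //; split=> // i.
    have := diam_pow_le_series i Ue; have [->|/set0P[z Uz]] := eqVneq (U i) set0.
      by move=> _; apply: diam_le.
    have dm := diam_ge0 Uz; rewrite (diam_powE _ Uz) => h.
    have {h} : (poweR (diam (U i)) s <= poweR d%:E s)%E.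
      by apply: le_trans h _; rewrite poweR_EFin lee_fin ge_min lexx orbT.
    rewrite !leNgt; apply: contra => h.
    case: (diam (U i)) dm h => [x| |]//=; rewrite ?gt_eqF// ?ltry//.
    by rewrite lee_fin !lte_fin => x0 dx; rewrite gt0_ltr_powR// ?nnegrE// ltW.
  have s00 : s = 0 by apply/eqP; rewrite eq_le s0 s_le0.
  subst s; clear s0 s_le0.
  have [|U AU Ue] := nA (Num.min e 2^-1); first by rewrite lt_min e0 invr_gt0 ltr0n.
  apply: ge_ereal_inf; exists (\sum_(0 <= i <oo) diam_pow 0 (U i))%E; last first.
    by apply: le_trans Ue _; rewrite lee_fin ge_min lexx.
  exists U => //; split=> // i.
  have := diam_pow_le_series i Ue; have [->|/set0P[z Uz]] := eqVneq (U i) set0.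
    by move=> _; apply: diam_le.
  rewrite (diam_powE _ Uz) poweRe0 lee_fin le_min => /andP[_].
  by rewrite leNgt invf_lt1// ltr1n.
apply: (@le_trans _ _ (hausdorff_premeasure s 1 A)).
  by apply: le_ereal_inf_tmp => _ [U _ <-]; apply: nneseries_ge0 => *; exact: diam_pow_ge0.
by apply: ereal_sup_ubound; exists 1 => /=.
Qed.

Lemma hausdorff_dim_le s A : 0 <= s -> content_null s A ->
  (hausdorff_dim A <= s%:E)%E.
Proof.
move=> s0 nA; apply: ereal_inf_lbound; exists s => //=; split=> //.
exact/hausdorff_measure0P.
Qed.

Lemma hausdorff_dim_ge (b : \bar R) A :
  (forall s, 0 <= s -> content_null s A -> (b <= s%:E)%E) ->
  (b <= hausdorff_dim A)%E.
Proof.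
move=> h; apply: le_ereal_inf_tmp => _ [s [s0 /(hausdorff_measure0P _ s0) nA] <-].
exact: h.
Qed.

Lemma content_null_subset s A B : A `<=` B -> content_null s B -> content_null s A.
Proof.
by move=> AB nB e /nB[U BU Ue]; exists U => //; exact: subset_trans BU.
Qed.

Lemma content_null_finite_cover s A (I : eqType) (U : I -> set R[i]) :
  (forall e : R, 0 < e -> exists2 r : seq I,
    (forall z, A z -> exists2 k, k \in r & U k z) &
    (\sum_(k <- r) diam_pow s (U k) <= e%:E)%E) -> content_null s A.
Proof.
move=> h e /h[r Ar re]; exists (nth set0 (map U r)).
  move=> z /Ar[k kr Uz]; exists (index k r) => //=.
  by rewrite (nth_map k) ?index_mem// nth_index.
rewrite (nneseries_split 0 (size r))//; last by move=> *; exact: diam_pow_ge0.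
rewrite add0n eseries0 ?adde0; last first.
  by move=> i ri _; rewrite nth_default ?size_map// diam_pow_set0.
by rewrite -(size_map U r) -(big_nth set0 xpredT (diam_pow s)) big_map.
Qed.

(** A map that contracts distances by a bounded factor at most pulls covers
    back to covers, at the cost of the factor [c `^ s]. *)
Lemma content_null_expanding s A B (g : R[i] -> R[i]) (c : R) : 0 <= s -> 0 < c ->
  (forall z, A z -> B (g z)) ->
  (forall z z', A z -> A z' -> cdist z z' <= c * cdist (g z) (g z')) ->
  content_null s B -> content_null s A.
Proof.
move=> s0 c0 gAB gc nB e e0.
have cs : 0 < c `^ s by exact: powR_gt0.
have [U BU Ue] := nB (e / c `^ s) (divr_gt0 e0 cs).
exists (fun i => [set z | A z /\ U i (g z)]).
  by move=> z Az; have [i _ Ui] := BU _ (gAB _ Az); exists i.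
apply: (@le_trans _ _ (\sum_(0 <= i <oo) (c `^ s)%:E * diam_pow s (U i))%E).
  apply: lee_nneseries => [i _ _|i _]; first exact: diam_pow_ge0.
  have [->|/set0P[z [Az Uz]]] := eqVneq [set z | A z /\ U i (g z)] set0.
    by rewrite diam_pow_set0 mule_ge0 ?diam_pow_ge0 ?lee_fin ?ltW.
  rewrite (@diam_powE _ [set z | A z /\ U i (g z)] z)// (diam_powE _ Uz).
  rewrite -poweR_EFin -poweRM ?lee_fin ?(ltW c0) ?(diam_ge0 Uz)//.
  apply: poweR_mono => //; first exact: (@diam_ge0 _ z).
  apply: diam_le => x y [Ax Ux] [Ay Uy].
  apply: (@le_trans _ _ (c%:E * (cdist (g x) (g y))%:E)%E).
    by rewrite -EFinM lee_fin gc.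
  by rewrite lee_pmul2l ?lte_fin//; exact: diam_ubound.
rewrite nneseriesZl; last by move=> *; exact: diam_pow_ge0.
apply: (@le_trans _ _ ((c `^ s)%:E * (e / c `^ s)%:E)%E).
  by rewrite lee_pmul2l ?lte_fin.
by rewrite -EFinM lee_fin mulrC divfK// gt_eqF.
Qed.

(** Cover the [k]-th set with total weight [e / 2 ^ k.+1] and enumerate the
    double family of covering sets. *)
Lemma content_null_bigcup s (A : nat -> set R[i]) :
  (forall k, content_null s (A k)) -> content_null s (\bigcup_k A k).
Proof.
move=> nA e e0.
have e2 k : 0 < e / (2 ^ k.+1)%:R by rewrite divr_gt0// ltr0n expn_gt0.
have /choice[U UP] k : exists V : nat -> set R[i], A k `<=` \bigcup_i V i /\
    (\sum_(0 <= i <oo) diam_pow s (V i) <= (e / (2 ^ k.+1)%:R)%:E)%E.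
  by have [V AV Ve] := nA k _ (e2 k); exists V.
have /card_esym/ppcard_eqP[f] := card_nat2.
exists (fun i => U (f i).1 (f i).2).
  move=> z [k _ /(proj1 (UP k))[i _ Uz]]; exists (f^-1%FUN (k, i)) => //=.
  by rewrite invK ?inE.
have d0 i j : (0 <= diam_pow s (U i j))%E by exact: diam_pow_ge0.
rewrite nneseries_esumT//.
rewrite -(@reindex_esum R _ _ setT setT f (fun p => diam_pow s (U p.1 p.2)))//.
have -> : [set: nat * nat] = [set: nat] `*`` (fun=> [set: nat]) by apply/seteqP; split.
rewrite -(@esum_esum R _ _ setT (fun=> setT) (fun i j => diam_pow s (U i j)))//.
rewrite -nneseries_esumT; last by move=> k; apply: esum_ge0.
apply: (@le_trans _ _ (\sum_(0 <= k <oo) (0 + (e / (2 ^ k.+1)%:R)%:E))%E).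
  apply: lee_nneseries => [k _ _|k _]; first exact: esum_ge0.
  by rewrite add0e -nneseries_esumT//; case: (UP k).
by apply: le_trans (epsilon_trick _ _ (ltW e0)) _; rewrite // eseries0// add0e.
Qed.

(** When the total weight is less than 1, every covering set has diameter at
    most 1, and then a larger exponent gives a smaller weight. *)
Lemma content_null_mono s (t : R) A : 0 <= s -> s <= t ->
  content_null s A -> content_null t A.
Proof.
move=> s0 st nA e e0.
(* Any bound below 1 would do in place of 1/2. *)
have [|U AU Ue] := nA (Num.min e 2^-1); first by rewrite lt_min e0 invr_gt0 ltr0n.
exists U => //; apply: (@le_trans _ _ (Num.min e 2^-1)%:E); last first.
  by rewrite lee_fin ge_min lexx.
apply: le_trans (Ue); apply: lee_nneseries => [i _ _|i _]; first exact: diam_pow_ge0.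
have := diam_pow_le_series i Ue; have [->|/set0P[z Uz]] := eqVneq (U i) set0.
  by rewrite !diam_pow_set0.
have := diam_ge0 Uz; rewrite !(diam_powE _ Uz).
have half1 : 2^-1 < 1 :> R by rewrite invf_lt1// ltr1n.
have [->|sn0] := eqVneq s 0.
  by rewrite poweRe0 lee_fin le_min [X in _ && X]leNgt half1 andbF.
have sp : 0 < s by rewrite lt_neqAle eq_sym sn0.
case: (diam (U i)) => [x| |]//=; last by rewrite (negPf sn0) leye_eq.
rewrite !lee_fin le_min => x0 /andP[_ xs].
have [->|xn0] := eqVneq x 0; first by rewrite !powR0 ?gt_eqF ?(lt_le_trans sp).
apply: ger_powR => //; rewrite lt_neqAle eq_sym xn0 x0/= leNgt; apply/negP => x1.
have : 1 `^ s <= x `^ s by apply: ge0_ler_powR; rewrite ?nnegrE// ltW.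
by rewrite powR1 => /le_trans/(_ xs); rewrite leNgt half1.
Qed.

Lemma hausdorff_dim_ge_of_not_null s A :
  ~ content_null s A -> (s%:E <= hausdorff_dim A)%E.
Proof.
move=> nnA; apply: hausdorff_dim_ge => t t0 nA; rewrite lee_fin leNgt.
by apply/negP => ts; apply: nnA; exact: content_null_mono (ltW ts) nA.
Qed.

End Hausdorff.

(** * Small powers *)

Section Powers.
Variable R : realType.

Lemma exists_pow_invn_le (s e : R) : 0 < s -> 0 < e ->
  exists2 n, (0 < n)%N & (n%:R^-1) `^ s <= e.
Proof.
move=> s0 e0; have es0 : 0 < e `^ s^-1 by exact: powR_gt0.
have [k] := ltr_add_invr es0; rewrite add0r => ke; exists k.+1 => //.
have -> : e = (e `^ s^-1) `^ s by rewrite -powRrM mulVf ?gt_eqF// powRr1// ltW.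
by apply: ge0_ler_powR; rewrite ?nnegrE ?ltW// invr_ge0.
Qed.

End Powers.

(** * Continued fractions and their distortion *)

Section ContinuedFractions.
Variable R : realType.
Implicit Types (u v : seq nat) (w : nat -> nat) (x y t : R).

(** The branch of the inverse Gauss map along [u]: [phi u x] is the finite
    continued fraction with letters [u] followed by the tail [x]. *)
Definition phi u x : R := foldr (fun a t => (a%:R + t)^-1) x u.

(** Numerator and denominator of [phi u x] as affine functions of [x]. At
    [x = 0] the denominator is the classical continuant of [u]. *)
Definition fracs u x : R * R :=
  foldr (fun a z => (z.2, a%:R * z.2 + z.1)) (x, 1) u.
Definition num u x := (fracs u x).1.
Definition den u x := (fracs u x).2.

Definition positive u := all (fun a => 0 < a)%N u.

Lemma num_cons a u x : num (a :: u) x = den u x. Proof. by []. Qed.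
Lemma den_cons a u x : den (a :: u) x = a%:R * den u x + num u x.
Proof. by []. Qed.

Lemma num_den_ge u x : positive u -> 0 <= x -> 0 <= num u x /\ 1 <= den u x.
Proof.
move=> + x0; elim: u => [//|a u IH] /= /andP[a0 /IH[n0 d1]].
rewrite num_cons den_cons; have : 1 <= a%:R :> R by rewrite ler1n.
by split; nra.
Qed.

Lemma den_gt0 u x : positive u -> 0 <= x -> 0 < den u x.
Proof. by move=> pu x0; have [_] := num_den_ge pu x0; exact: lt_le_trans. Qed.

Lemma phi_num_den u x : positive u -> 0 <= x -> phi u x = num u x / den u x.
Proof.
move=> + x0; elim: u => [_|a u IH] /=; first by rewrite divr1.
move=> /andP[a0 pu]; rewrite IH// num_cons den_cons.
have d0 := den_gt0 pu x0; have [n0 _] := num_den_ge pu x0.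
have : 1 <= a%:R :> R by rewrite ler1n.
move=> a1; field; rewrite !gt_eqF//; nra.
Qed.

Lemma phi_cat u v x : phi (u ++ v) x = phi u (phi v x).
Proof. by rewrite /phi foldr_cat. Qed.

Lemma phi_itv u x : positive u -> 0 <= x <= 1 -> 0 <= phi u x <= 1.
Proof.
move=> + x01; elim: u => [//|a u IH] /= /andP[a0 /IH/andP[p0 p1]].
have : 1 <= a%:R :> R by rewrite ler1n.
by move=> a1; rewrite invr_ge0 invf_le1; lra.
Qed.

(** Appending a word acts on the pair through a product of matrices; in terms
    of values, the denominators are multiplicative cocycles. *)
Lemma num_den_cat u v x : positive v -> 0 <= x ->
  num (u ++ v) x = num u (phi v x) * den v x /\
  den (u ++ v) x = den u (phi v x) * den v x.
Proof.
move=> pv x0; have d0 := den_gt0 pv x0; elim: u => [|a u [IHn IHd]] /=.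
  rewrite /den/= mul1r; split => //.
  by rewrite {2}/num/= phi_num_den// mulfVK// gt_eqF.
by rewrite num_cons den_cons IHn IHd num_cons den_cons; split => //; ring.
Qed.

Lemma num_den_mono u x y : 0 <= x -> x <= y ->
  num u x <= num u y /\ den u x <= den u y.
Proof.
move=> x0 xy; elim: u => [//|a u [IHn IHd]].
by rewrite !num_cons !den_cons; split=> //; rewrite lerD// ler_wpM2l.
Qed.

(** Bounded distortion: the slope of the affine function [den u] is at most its
    value at 0, because a continuant is at least the one of a shorter prefix.
    The induction must also follow [num u + den u], since [num u 1 <= 2 * num u 0]
    fails for the empty word. *)
Lemma den_1_le u : positive u -> den u 1 <= 2 * den u 0.
Proof.
move=> pu; suff: den u 1 <= 2 * den u 0 /\
    num u 1 + den u 1 <= 2 * (num u 0 + den u 0) by case.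
elim: u pu => [_|a u IH] /=; first by rewrite /num /den/=; split; lra.
move=> /andP[a0 /IH[IH1 IH2]]; rewrite !num_cons !den_cons.
have : 1 <= a%:R :> R by rewrite ler1n.
by split; nra.
Qed.

(** The matrix of a branch has determinant 1 or -1. *)
Lemma phi_dist u x y : positive u -> 0 <= x -> 0 <= y ->
  `|phi u x - phi u y| = `|x - y| / (den u x * den u y).
Proof.
move=> + x0 y0; elim: u => [_|a u IH] /=; first by rewrite /den/= mulr1 divr1.
move=> /andP[a0 pu].
have dx0 := den_gt0 pu x0; have [nx0 _] := num_den_ge pu x0.
have dy0 := den_gt0 pu y0; have [ny0 _] := num_den_ge pu y0.
have a1 : 1 <= a%:R :> R by rewrite ler1n.
have hx : 0 < den (a :: u) x by rewrite den_cons; nra.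
have hy : 0 < den (a :: u) y by rewrite den_cons; nra.
have -> : (a%:R + phi u x)^-1 - (a%:R + phi u y)^-1 =
    - (phi u x - phi u y) * (den u x * den u y / (den (a :: u) x * den (a :: u) y)).
  rewrite !phi_num_den// !den_cons; field.
  by rewrite !gt_eqF//; rewrite -!den_cons.
rewrite normrM normrN IH// [X in _ * X]ger0_norm; last first.
  by rewrite divr_ge0// ?mulr_ge0// ltW.
by field; rewrite !gt_eqF.
Qed.

(** The size of the cylinder of [u], normalised by 1/4 so that it becomes
    supermultiplicative ([lam_cat]); the derivative of [phi u] on the unit
    interval lies between [lam u] and [4 * lam u]. *)
Definition lam u : R := (2 * den u 0) ^- 2.

Lemma lam_gt0 u : positive u -> 0 < lam u.
Proof. by move=> pu; rewrite /lam invr_gt0 exprn_gt0// mulr_gt0// den_gt0. Qed.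

Lemma den_itv u x : positive u -> 0 <= x <= 1 -> den u 0 <= den u x <= 2 * den u 0.
Proof.
move=> pu /andP[x0 x1]; have [_ ->] := num_den_mono u (lexx 0) x0.
have [_ h] := num_den_mono u x0 x1; exact: le_trans (den_1_le pu).
Qed.

Lemma phi_dist_le u x y : positive u -> 0 <= x <= 1 -> 0 <= y <= 1 ->
  `|phi u x - phi u y| <= 4 * lam u * `|x - y|.
Proof.
move=> pu x01 y01; have [x0 y0] : 0 <= x /\ 0 <= y by lra.
rewrite phi_dist// mulrC ler_wpM2r//.
have /andP[hx _] := den_itv pu x01; have /andP[hy _] := den_itv pu y01.
have d0 := den_gt0 pu (lexx 0).
have -> : 4 * lam u = (den u 0 * den u 0)^-1 by rewrite /lam; field; rewrite gt_eqF.
by rewrite lef_pV2 ?posrE ?mulr_gt0// ?(lt_le_trans d0)// ler_pM// ltW.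
Qed.

Lemma phi_dist_ge u x y : positive u -> 0 <= x <= 1 -> 0 <= y <= 1 ->
  lam u * `|x - y| <= `|phi u x - phi u y|.
Proof.
move=> pu x01 y01; have [x0 y0] : 0 <= x /\ 0 <= y by lra.
rewrite phi_dist// [leRHS]mulrC ler_wpM2r//.
have /andP[hx hx'] := den_itv pu x01; have /andP[hy hy'] := den_itv pu y01.
have d0 := den_gt0 pu (lexx 0).
have dx := lt_le_trans d0 hx; have dy := lt_le_trans d0 hy.
by rewrite /lam lef_pV2 ?posrE ?mulr_gt0 ?exprn_gt0 ?mulr_gt0// expr2 ler_pM// ltW.
Qed.

Lemma positive_cat u v : positive (u ++ v) = positive u && positive v.
Proof. exact: all_cat. Qed.

(** The factor 2 of bounded distortion is absorbed by the normalisation. *)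
Lemma lam_cat u v : positive u -> positive v -> lam u * lam v <= lam (u ++ v).
Proof.
move=> pu pv; rewrite /lam; have [_ ->] := num_den_cat u pv (lexx 0).
have d0 := den_gt0 pu (lexx 0); have d1 := den_gt0 pv (lexx 0).
have /andP[h1 h2] := den_itv pu (phi_itv (x := 0) pv ltac:(lra)).
have e0 := lt_le_trans d0 h1.
rewrite -invfM -exprMn lef_pV2 ?posrE ?exprn_gt0 ?mulr_gt0//.
apply: lerXn2r; rewrite ?nnegrE ?mulr_ge0 ?(ltW d0) ?(ltW d1) ?(ltW e0)//.
have := ler_wpM2r (ltW d1) h2; lra.
Qed.

Lemma den_ge_size u : positive u -> (size u)%:R <= den u 0.
Proof.
move=> pu; suff: (size u)%:R <= den u 0 /\ (u != [::] -> 1 <= num u 0) by case.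
elim: u pu => [_|a u IH] /=; first by split.
move=> /andP[a0 pu]; have [IH1 IH2] := IH pu; have [n0 d1] := num_den_ge pu (lexx 0).
rewrite num_cons den_cons -natr1; have a1 : 1 <= a%:R :> R by rewrite ler1n.
split=> //; case: (eqVneq u [::]) => [->|/IH2]; last by nra.
by rewrite /num /den/=; lra.
Qed.

Lemma lam_le u : positive u -> (0 < size u)%N -> 4 * lam u <= (size u)%:R^-1.
Proof.
move=> pu u0; have d := den_ge_size pu; have d0 := den_gt0 pu (lexx 0).
have -> : 4 * lam u = (den u 0 * den u 0)^-1 by rewrite /lam; field; rewrite gt_eqF.
have [_ d1] := num_den_ge pu (lexx 0).
by rewrite lef_pV2 ?posrE ?ltr0n ?mulr_gt0//; nra.
Qed.

Lemma lam_powR_le n u (s : R) : 0 <= s -> positive u -> size u = n -> (0 < n)%N ->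
  (4 * lam u) `^ s <= n%:R^-1 `^ s.
Proof.
move=> s0 pu un n0; apply: ge0_ler_powR; rewrite ?nnegrE ?invr_ge0//.
  by rewrite mulr_ge0// ltW// lam_gt0.
by rewrite -un lam_le// un.
Qed.

Lemma lam_ge (N : nat) u : positive u -> all (fun a => a <= N)%N u ->
  (2 * N.+1%:R ^+ size u) ^- 2 <= lam u.
Proof.
move=> pu uN; have d0 := den_gt0 pu (lexx 0).
suff [h _] : den u 0 <= N.+1%:R ^+ size u /\ num u 0 <= den u 0.
  have N0 : 0 <= N.+1%:R ^+ size u :> R by exact: exprn_ge0.
  rewrite /lam lef_pV2 ?posrE ?exprn_gt0 ?mulr_gt0 ?exprn_gt0//.
  by apply: lerXn2r; rewrite ?nnegrE ?mulr_ge0 ?(ltW d0)// ler_pM2l.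
elim: u pu uN {d0} => [_ _|a u IH] /=; first by rewrite /num /den/=; split.
move=> /andP[a0 pu] /andP[aN /(IH pu)[IH1 IH2]].
have [n0 d1] := num_den_ge pu (lexx 0).
have a1 : 1 <= a%:R :> R by rewrite ler1n.
have aN' : a%:R <= N%:R :> R by rewrite ler_nat.
have N0 : 0 <= N.+1%:R :> R by [].
rewrite num_cons den_cons exprS; split; last by nra.
apply: (@le_trans _ _ (N.+1%:R * den u 0)); last exact: ler_wpM2l.
by rewrite -natr1; nra.
Qed.

Definition tail_word k w : nat -> nat := fun i => w (k + i)%N.
Definition cfr w : R := limn (convergent R w).

Lemma mkseqD w m n : mkseq w (m + n) = mkseq w m ++ mkseq (tail_word m w) n.
Proof.
rewrite /mkseq iotaD map_cat; congr (_ ++ _).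
by rewrite add0n -[in LHS](addn0 m) iotaDl -map_comp.
Qed.

Lemma convergentE w n : convergent R w n = phi (mkseq w n) 0.
Proof.
elim: n w => [//|n IH] w; rewrite -add1n mkseqD /= IH.
by congr (_ + phi _ _)^-1.
Qed.

Lemma positive_mkseq w n : positive_word w -> positive (mkseq w n).
Proof. by move=> pw; apply/allP => _ /mapP[i _ ->]; exact: pw. Qed.

Lemma positive_tail k w : positive_word w -> positive_word (tail_word k w).
Proof. by move=> pw i; exact: pw. Qed.

Lemma convergent_itv w n : positive_word w -> 0 <= convergent R w n <= 1.
Proof.
by move=> pw; rewrite convergentE phi_itv ?positive_mkseq// lexx ler01.
Qed.

Lemma convergent_cauchy w m n : positive_word w -> (0 < m <= n)%N ->
  `|convergent R w m - convergent R w n| <= m%:R^-1.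
Proof.
move=> pw /andP[m0 /subnKC<-]; rewrite !convergentE mkseqD phi_cat.
set k := (n - m)%N.
have p2 := positive_mkseq k (positive_tail m pw).
have := phi_itv (x := 0) p2 ltac:(lra); set x := phi _ _ => x01.
apply: le_trans (phi_dist_le _ _ _) _; rewrite ?lexx ?ler01 ?positive_mkseq//.
have := lam_le (positive_mkseq m pw); rewrite size_mkseq => /(_ m0).
apply: le_trans; apply: ler_piMr.
  by rewrite mulr_ge0// ltW ?lam_gt0 ?positive_mkseq.
by rewrite sub0r normrN ger0_norm; lra.
Qed.

Lemma convergent_cvg w : positive_word w -> convergent R w @ \oo --> cfr w.
Proof.
move=> pw; apply: cauchy_cvg; apply: cauchy_exP => e e0.
have [k ke] : exists k, k.+1%:R^-1 < e.
  by have [k] := ltr_add_invr e0; rewrite add0r; exists k.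
exists (convergent R w k.+1); exists k.+1 => // n /= kn.
by apply: le_lt_trans ke; exact: (@convergent_cauchy w k.+1 n pw).
Qed.

Lemma cfr_itv w : positive_word w -> 0 <= cfr w <= 1.
Proof.
move=> pw; have cw : cvgn (convergent R w).
  by apply/cvg_ex; exists (cfr w); exact: convergent_cvg.
apply/andP; split; [apply: limr_ge => //|apply: limr_le => //].
  by apply: nearW => n; case/andP: (convergent_itv n pw).
by apply: nearW => n; case/andP: (convergent_itv n pw).
Qed.

Lemma cfr_tail1 w : positive_word w -> cfr w = ((w 0%N)%:R + cfr (tail_word 1 w))^-1.
Proof.
move=> pw; have h := convergent_cvg pw.
have h1 := convergent_cvg (positive_tail 1 pw).
have /andP[c0 _] := cfr_itv (positive_tail 1 pw).
have w0 : 1 <= (w 0%N)%:R :> R by rewrite ler1n; exact: pw.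
suff h' : convergent R w @ \oo --> ((w 0%N)%:R + cfr (tail_word 1 w))^-1.
  exact: (cvg_unique _ h h').
rewrite -cvg_shiftS.
apply: (@cvgV _ _ _ _ (fun n => (w 0%N)%:R + convergent R (tail_word 1 w) n)).
  by rewrite gt_eqF//; lra.
by apply: cvgD => //; exact: cvg_cst.
Qed.

Lemma cfr_phi w m : positive_word w -> cfr w = phi (mkseq w m) (cfr (tail_word m w)).
Proof.
elim: m w => [//|m IH] w pw.
rewrite cfr_tail1// -(add1n m) mkseqD/= (IH (tail_word 1 w))//; exact: positive_tail.
Qed.

(** The lower bound holds since the first letter is at most [N]; the upper bound
    follows from the lower bound for the tail. *)
Lemma cfr_itv_N (N : nat) w : positive_word w -> (forall i, w i <= N)%N ->
  N.+2%:R^-1 <= cfr w <= 1 - N.+2%:R^-1.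
Proof.
suff H w' : positive_word w' -> (forall i, w' i <= N)%N -> N.+1%:R^-1 <= cfr w'.
  move=> pw wN; have wN' : (w 0%N)%:R <= N%:R :> R by rewrite ler_nat.
  have p1 := positive_tail 1 pw.
  have := H _ p1 (fun i => wN (1 + i)%N); have := H _ pw wN.
  have w0 : 1 <= (w 0%N)%:R :> R by rewrite ler1n; exact: pw.
  have -> : N.+2%:R = N.+1%:R + 1 :> R by rewrite natr1.
  have m0 : 0 < N.+1%:R :> R by [].
  move: (N.+1%:R) m0 => m m0 h1 h2; apply/andP; split.
    by apply: le_trans h1; rewrite lef_pV2 ?posrE//; lra.
  have -> : 1 - (m + 1)^-1 = (1 + m^-1)^-1.
    by field; rewrite !gt_eqF//; lra.
  have mV : 0 < m^-1 by rewrite invr_gt0.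
  by rewrite cfr_tail1// lef_pV2 ?posrE; lra.
move=> pw wN; have wN' : (w' 0%N)%:R <= N%:R :> R by rewrite ler_nat.
rewrite cfr_tail1//; have /andP[c0 c1] := cfr_itv (positive_tail 1 pw).
have w0 : 1 <= (w' 0%N)%:R :> R by rewrite ler1n; exact: pw.
by rewrite lef_pV2 ?posrE// -?natr1; lra.
Qed.

(** Two continued fractions with bounded letters that branch after [m] letters
    are as far apart as the cylinder where they branch allows. Their tails stay
    away from 0 and 1, the common end points of neighbouring cylinders. *)
Lemma cfr_separated (N m : nat) w w' : positive_word w -> positive_word w' ->
  (forall i, w i <= N)%N -> (forall i, w' i <= N)%N ->
  (forall i, i < m -> w i = w' i)%N -> w m != w' m ->
  lam (mkseq w m) * (2 * N.+2%:R ^- 3) <= `|cfr w - cfr w'|.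
Proof.
move=> pw pw' wN wN' eqw neqw.
rewrite (cfr_phi m pw) (cfr_phi m pw').
have -> : mkseq w' m = mkseq w m.
  by apply/eq_in_map => i; rewrite mem_iota => /eqw.
have ps := positive_tail m pw; have ps' := positive_tail m pw'.
apply: le_trans (phi_dist_ge _ _ _); rewrite ?positive_mkseq ?cfr_itv//.
rewrite ler_pM2l ?lam_gt0 ?positive_mkseq//.
have := cfr_itv_N ps (fun i => wN _); have := cfr_itv_N ps' (fun i => wN' _).
have p2 := positive_tail 1 ps; have p2' := positive_tail 1 ps'.
have := cfr_itv_N p2 (fun i => wN _); have := cfr_itv_N p2' (fun i => wN' _).
have e0 : 0 < N.+2%:R^-1 :> R by [].
rewrite (cfr_tail1 ps) (cfr_tail1 ps') -exprVn.
have -> : tail_word m w 0 = w m by rewrite /tail_word addn0.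
have -> : tail_word m w' 0 = w' m by rewrite /tail_word addn0.
move: (cfr _) (cfr _) (N.+2%:R^-1) e0 => x y e e0 hy hx.
set a : R := (w m)%:R; set b : R := (w' m)%:R => hb ha.
have a1 : 1 <= a by rewrite ler1n; exact: pw.
have b1 : 1 <= b by rewrite ler1n; exact: pw'.
have ab : 1 <= `|a - b|.
  move: neqw; rewrite neq_ltn => /orP[] h.
    have ab : a + 1 <= b by rewrite natr1 ler_nat.
    by rewrite ler0_norm; lra.
  have ba : b + 1 <= a by rewrite natr1 ler_nat.
  by rewrite ger0_norm; lra.
have -> : (a + x)^-1 - (b + y)^-1 = (a + x)^-1 * (b + y)^-1 * ((b - a) + (y - x)).
  by field; apply/andP; split; rewrite gt_eqF//; lra.
rewrite 2!normrM [`|(a + x)^-1|]ger0_norm ?[`|(b + y)^-1|]ger0_norm; try lra.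
have h : 2 * e <= `|b - a + (y - x)|.
  have := lerB_normD (b - a) (y - x); rewrite distrC.
  have : `|y - x| <= 1 - 2 * e by rewrite ler_norml; lra.
  by move: ab; lra.
have -> : 2 * e ^+ 3 = (e * e) * (2 * e) by ring.
by apply: ler_pM; rewrite ?mulr_ge0//; try lra; apply: ler_pM; lra.
Qed.

End ContinuedFractions.

(** * Mass distributions on trees *)

Section Tree.
Variables (R : realType) (K : eqType) (F : seq K) (p : K -> R).
Hypotheses (uniqF : uniq F) (p_ge0 : forall u, 0 <= p u).
Hypothesis sum_p : \sum_(u <- F) p u = 1.

Definition mass (v : seq K) : R := \prod_(u <- v) p u.

Lemma mass_ge0 v : 0 <= mass v.
Proof. by apply: prodr_ge0 => u _. Qed.

Lemma mass_rcons v u : mass (rcons v u) = mass v * p u.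
Proof. by rewrite /mass -cats1 big_cat big_seq1. Qed.

(** Suppose that the total mass is less than 1. Call a node bad if the given
    cylinders inside it have total mass less than its own mass; the root is
    bad. Masses add up over the children of a node, so a bad node has a bad
    child. The branch of bad nodes obtained in this way lies in one of the
    cylinders, and the node of this cylinder cannot be bad. *)
Lemma cylinder_cover_mass (v : nat -> seq K) :
  (forall c : nat -> K, (forall k, c k \in F) ->
    exists i, mkseq c (size (v i)) = v i) ->
  (1 <= \sum_(0 <= i <oo) (mass (v i))%:E)%E.
Proof.
move=> cover; rewrite leNgt; apply/negP => lt1.
pose below w i : \bar R := (if prefix w (v i) then mass (v i) else 0)%:E.
have below_ge0 w i : (0 <= below w i)%E.
  by rewrite lee_fin; case: ifP => // _; exact: mass_ge0.
pose bad w := (\sum_(0 <= i <oo) below w i < (mass w)%:E)%E.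
have bad0 : bad [::].
  rewrite /bad /mass big_nil (eq_eseriesr (g := fun i => (mass (v i))%:E))//.
  by move=> i _; rewrite /below prefix0s.
(* A cylinder strictly below [w] lies below exactly one child of [w]. *)
have split_below w i : (\sum_(u <- F) below (rcons w u) i <= below w i)%E.
  rewrite /below sumEFin lee_fin.
  case: (boolP (prefix w (v i))) => [/prefixP[[|a y] ->]|npre]; last 1 first.
  - rewrite big1_seq// => u _; case: ifPn => // /prefixP[y vE].
    by case/negP: npre; apply/prefixP; exists (u :: y); rewrite vE cat_rcons.
  - rewrite big1_seq ?mass_ge0// => u _; case: ifPn => // /size_prefix.
    by rewrite cats0 size_rcons ltnn.
  have pre u : prefix (rcons w u) (w ++ a :: y) = (u == a).
    apply/prefixP/eqP => [[z]|->]; last by exists y; rewrite cat_rcons.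
    by rewrite cat_rcons => /eqP; rewrite eqseq_cat// eqxx/= eqseq_cons => /andP[/eqP].
  under eq_bigr do rewrite pre.
  case: (boolP (a \in F)) => aF.
    rewrite (bigD1_seq a)//= eqxx big1 ?addr0 ?prefix_prefix// => u /negPf->//.
  rewrite big1_seq ?prefix_prefix ?mass_ge0// => u /andP[_ uF].
  by case: eqP => // ua; rewrite ua (negPf aF) in uF.
have bad_child w : bad w -> exists u, u \in F /\ bad (rcons w u).
  move=> badw; apply: contrapT => none.
  move: badw; rewrite /bad ltNge => /negP; apply.
  have -> : mass w = \sum_(u <- F) mass (rcons w u).
    by under eq_bigr do rewrite mass_rcons; rewrite -mulr_sumr sum_p mulr1.
  rewrite -sumEFin.
  apply: (@le_trans _ _ (\sum_(u <- F) \sum_(0 <= i <oo) below (rcons w u) i)%E).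
    rewrite big_seq [leRHS]big_seq; apply: lee_sum => u uF.
    by rewrite leNgt; apply/negP => h; apply: none; exists u.
  rewrite -nneseries_sum//; apply: lee_nneseries => // i _ _.
  exact: sume_ge0.
have /choice[nx nxP] w : exists u, bad w -> u \in F /\ bad (rcons w u).
  have [/bad_child[u ?]|nb] := pselect (bad w); first by exists u.
  case: F sum_p => [|u F' _]; last by exists u => /nb.
  by rewrite big_nil => /esym/eqP; rewrite oner_eq0.
pose W n := iter n (fun w => rcons w (nx w)) [::].
have badW n : bad (W n) by elim: n => //= n /nxP[].
pose c n := nx (W n).
have cW n : mkseq c n = W n by elim: n => // n IH; rewrite mkseqS IH.
have [|i] := cover c; first by move=> k; case: (nxP _ (badW k)).
rewrite cW => Wi; have := badW (size (v i)); rewrite Wi /bad ltNge => /negP; apply.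
apply: le_trans (nneseries_lim_ge i.+1 _) => [|k _ _]; last exact: below_ge0.
rewrite big_nat_recr//= -[leLHS]add0e leeD ?sume_ge0//.
by rewrite /below prefix_refl.
Qed.

End Tree.

(** * A lower bound for the dimension of block sequences *)

Section Blocks.
Variables (R : realType) (n N : nat) (F : seq (seq nat)).
Hypothesis n_gt0 : (0 < n)%N.
Hypothesis sizeF : forall u, u \in F -> size u = n.
Hypothesis positiveF : forall u, u \in F -> positive u.
Hypothesis letterF : forall u, u \in F -> all (fun a => a <= N)%N u.
Implicit Types (c : nat -> seq nat).

Definition block_seq c := forall k, c k \in F.

Definition concat_blocks c : nat -> nat := fun i => nth 0%N (c (i %/ n)%N) (i %% n)%N.

Lemma concat_blocks_letter c i : block_seq c -> (0 < concat_blocks c i <= N)%N.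
Proof.
move=> cF; have h : concat_blocks c i \in c (i %/ n)%N.
  by rewrite mem_nth// sizeF// ltn_mod.
by rewrite (allP (positiveF (cF _)) _ h) (allP (letterF (cF _)) _ h).
Qed.

Lemma concat_blocks_positive c : block_seq c -> positive_word (concat_blocks c).
Proof. by move=> cF i; case/andP: (concat_blocks_letter i cF). Qed.

Lemma concat_blocks_le c i : block_seq c -> (concat_blocks c i <= N)%N.
Proof. by move=> cF; case/andP: (concat_blocks_letter i cF). Qed.

Lemma concat_blocksE c k r : (r < n)%N -> concat_blocks c (k * n + r) = nth 0%N (c k) r.
Proof. by move=> rn; rewrite /concat_blocks divnMDl// modnMDl divn_small// modn_small// addn0. Qed.

Lemma mkseq_concat_blocks c k : block_seq c -> mkseq (concat_blocks c) (k * n) = flatten (mkseq c k).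
Proof.
move=> cF; elim: k => [//|k IH].
rewrite mkseqS -cats1 flatten_cat /= cats0 -IH mulSn addnC mkseqD; congr (_ ++ _).
apply: (@eq_from_nth _ 0%N); rewrite size_mkseq ?sizeF// => r rn.
by rewrite nth_mkseq// /tail_word concat_blocksE.
Qed.

(** The separation constant: the first factor bounds [lam] from below on the
    common prefix of two distinct blocks, the second is the separation of
    [cfr_separated], and 1/4 undoes the normalisation of [lam]. *)
Definition gap : R := (2 * N.+1%:R ^+ n) ^- 2 * (2 * N.+2%:R ^- 3) / 4.

Lemma gap_gt0 : 0 < gap.
Proof.
by rewrite /gap divr_gt0// mulr_gt0// ?invr_gt0 ?exprn_gt0 ?mulr_gt0 ?invr_gt0 ?exprn_gt0.
Qed.

Lemma positive_flatten c k : block_seq c -> positive (flatten (mkseq c k)).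
Proof. by move=> cF; rewrite -mkseq_concat_blocks// positive_mkseq//; exact: concat_blocks_positive. Qed.

Lemma concat_blocks_separated c c' j : block_seq c -> block_seq c' ->
  (forall i, (i < j)%N -> c i = c' i) -> c j != c' j ->
  gap * (4 * lam R (flatten (mkseq c j))) <=
    `|cfr R (concat_blocks c) - cfr R (concat_blocks c')|.
Proof.
move=> cF c'F eqc neqc.
have /ex_minnP[r /andP[rn neqr] rmin] :
    exists r, (r < n)%N && (nth 0%N (c j) r != nth 0%N (c' j) r).
  apply: contrapT => none; case/eqP: neqc.
  apply: (@eq_from_nth _ 0%N); rewrite !sizeF// => r rn.
  by apply/eqP/negPn/negP => h; apply: none; exists r; rewrite rn.
have pc := concat_blocks_positive cF; have pc' := concat_blocks_positive c'F.
apply: le_trans (@cfr_separated R N (j * n + r) _ _ pc pc' _ _ _ _) => //; first last.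
- by rewrite !concat_blocksE.
- move=> i; case: (ltnP i (j * n)) => [ij _|].
    by rewrite /concat_blocks eqc// ltn_divLR.
  move=> /subnKC <-; rewrite ltn_add2l => ir.
  have irn := ltn_trans ir rn.
  rewrite !concat_blocksE//; apply/eqP/negPn/negP => h.
  by have := rmin (i - j * n)%N; rewrite irn h leqNgt ir => /(_ isT).
- by move=> i; exact: concat_blocks_le.
- by move=> i; exact: concat_blocks_le.
have -> x : gap * (4 * x) = (2 * N.+1%:R ^+ n) ^- 2 * x * (2 * N.+2%:R ^- 3).
  by rewrite /gap; move: (_ ^- 2) (2 * _ ^- 3) => b d; field.
rewrite ler_wpM2r ?mulr_ge0 ?invr_ge0 ?exprn_ge0//.
rewrite mkseqD mkseq_concat_blocks// mulrC.
have ps := positive_tail (j * n) pc.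
apply: le_trans (lam_cat _ _ _); rewrite ?positive_flatten ?positive_mkseq//.
rewrite ler_pM2l ?lam_gt0 ?positive_flatten//.
apply: le_trans (lam_ge _ (positive_mkseq r ps) _); last first.
  by apply/allP => _ /mapP[i _ ->]; exact: concat_blocks_le.
rewrite size_mkseq lef_pV2 ?posrE ?exprn_gt0 ?mulr_gt0 ?exprn_gt0//.
apply: lerXn2r; rewrite ?nnegrE ?mulr_ge0 ?exprn_ge0// ler_pM2l//.
by rewrite ler_weXn2l ?ler1n// ltnW.
Qed.

Variable s : R.
Hypothesis s_gt0 : 0 < s.
Hypothesis uniqF : uniq F.
Hypothesis sum_lam : 1 <= \sum_(u <- F) lam R u `^ s.

(** The weights are normalised to have sum 1; as the sum of [lam u `^ s] is at
    least 1, they do not exceed [lam u `^ s]. *)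
Let weight u : R := if u \in F then lam R u `^ s / (\sum_(u <- F) lam R u `^ s) else 0.

Let sum_gt0 : 0 < \sum_(u <- F) lam R u `^ s.
Proof. exact: lt_le_trans sum_lam. Qed.

Let weight_ge0 u : 0 <= weight u.
Proof. by rewrite /weight; case: ifP => // _; rewrite divr_ge0 ?powR_ge0// ltW. Qed.

Let sum_weight : \sum_(u <- F) weight u = 1.
Proof.
rewrite (eq_big_seq (fun u => lam R u `^ s / \sum_(u <- F) lam R u `^ s)).
  by rewrite -mulr_suml divff// gt_eqF.
by move=> u uF; rewrite /weight uF.
Qed.

(** Supermultiplicativity of [lam], one block at a time; the factor 4 is the
    value of [1 / lam] at the empty word. *)
Let mass_le v : all (fun u => u \in F) v -> mass weight v <= (4 * lam R (flatten v)) `^ s.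
Proof.
have l0 u : positive u -> 0 <= lam R u by move=> /(lam_gt0 R) /ltW.
elim: v => [_|u v IH] /=.
  rewrite /mass big_nil /lam /den/= (_ : 4 * _ = 1) ?powR1//.
  by rewrite mulr1 (_ : 4 = 2 ^+ 2) ?divff// -natrX.
move=> /andP[uF vF]; rewrite /mass big_cons.
have pu := positiveF uF.
have pv : positive (flatten v).
  by elim: v vF {IH} => //= x v IH /andP[xF vF]; rewrite positive_cat positiveF// IH.
apply: (@le_trans _ _ ((lam R u * (4 * lam R (flatten v))) `^ s)).
  rewrite powRM ?mulr_ge0 ?l0//.
  apply: ler_pM => //; rewrite ?IH//; first exact: mass_ge0.
  by rewrite /weight uF ler_pdivrMr// ler_peMr// powR_ge0.
apply: ge0_ler_powR; rewrite ?nnegrE ?mulr_ge0 ?l0 ?positive_cat ?pu ?(ltW s_gt0)//.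
by rewrite mulrCA ler_pM2l//; exact: lam_cat.
Qed.

Let all_block_seq c k : block_seq c -> all (fun u => u \in F) (mkseq c k).
Proof. by move=> cF; apply/allP => _ /mapP[i _ ->]. Qed.

Let mass_small c (e : R) : block_seq c -> 0 < e -> exists k, mass weight (mkseq c k) <= e.
Proof.
move=> cF e0; have [k k0 ke] := exists_pow_invn_le s_gt0 e0; exists k.
apply: le_trans (mass_le (all_block_seq k cF)) _; apply: le_trans ke.
have pf := positive_flatten k cF.
have kn0 : (0 < k * n)%N by rewrite muln_gt0 k0.
apply: le_trans (lam_powR_le (ltW s_gt0) pf _ kn0) _.
  by rewrite -mkseq_concat_blocks// size_mkseq.
apply: ge0_ler_powR; rewrite ?nnegrE ?invr_ge0 ?(ltW s_gt0)//.
by rewrite lef_pV2 ?posrE ?ltr0n// ler_nat leq_pmulr.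
Qed.

(** A covering set [U] may be replaced by one cylinder of comparable mass. If
    two sequences in [U] differ, take the first index at which any sequence in
    [U] leaves a fixed one: all of them share the blocks before it, and [U]
    contains two points separated at that level. If [U] contains at most one
    sequence, a long prefix of it has arbitrarily small mass; this is the
    reason for the error term [e]. *)
Let node U (e : R) : 0 < e -> exists v,
  (forall c, block_seq c -> U (cfr R (concat_blocks c))%:C%C -> mkseq c (size v) = v) /\
  ((mass weight v)%:E <= ((gap `^ s)^-1)%:E * diam_pow s U + e%:E)%E.
Proof.
move=> e0.
have dU : (0 <= ((gap `^ s)^-1)%:E * diam_pow s U)%E.
  by rewrite mule_ge0 ?diam_pow_ge0// lee_fin invr_ge0 powR_ge0.
have [[c [cF Uc]]|none] :=
    pselect (exists c, block_seq c /\ U (cfr R (concat_blocks c))%:C%C); last first.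
  have [u uF] : exists u, u \in F.
    case: F sum_lam => [|u F' _]; last by exists u; rewrite inE eqxx.
    by rewrite big_nil ler10.
  have cF : block_seq (fun=> u) by [].
  have [k ke] := mass_small cF e0; exists (mkseq (fun=> u) k); split.
    by move=> c cF' Uc; case: none; exists c.
  by apply: le_trans (leeDr _ dU); rewrite lee_fin.
have [[j0 j0P]|none] := pselect (exists j, exists c',
    [/\ block_seq c', U (cfr R (concat_blocks c'))%:C%C & c j != c' j]); last first.
  have [k ke] := mass_small cF e0; exists (mkseq c k); split.
    move=> c' c'F Uc'; rewrite size_mkseq; apply/eq_in_map => j _.
    by apply/eqP/negPn/negP => h; apply: none; exists j, c'; rewrite eq_sym.
  by apply: le_trans (leeDr _ dU); rewrite lee_fin.
have ex : exists j, `[< exists c',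
    [/\ block_seq c', U (cfr R (concat_blocks c'))%:C%C & c j != c' j] >].
  by exists j0; apply/asboolP.
have [j /asboolP[c' [c'F Uc' neqj]] jmin] := ex_minnP ex.
have agree c'' : block_seq c'' -> U (cfr R (concat_blocks c''))%:C%C ->
    forall i, (i < j)%N -> c i = c'' i.
  move=> c''F Uc'' i ij; apply/eqP/negPn/negP => h.
  by have := jmin i; rewrite leqNgt ij => /(_ _)/negP[]//; apply/asboolP; exists c''.
exists (mkseq c j); split.
  move=> c'' c''F Uc''; rewrite size_mkseq; apply/eq_in_map => i.
  by rewrite mem_iota => /(agree _ c''F Uc'') ->.
rewrite -[leLHS]adde0; apply: leeD; last by rewrite lee_fin ltW.
apply: (@le_trans _ _ (((gap `^ s)^-1)%:E *
    (cdist (cfr R (concat_blocks c))%:C%C (cfr R (concat_blocks c'))%:C%C `^ s)%:E)%E); last first.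
  rewrite lee_pmul2l ?lte_fin ?invr_gt0 ?powR_gt0 ?gap_gt0//.
  exact: diam_pow_ge (ltW s_gt0) Uc Uc'.
rewrite -EFinM lee_fin cdist_real mulrC ler_pdivlMr ?powR_gt0 ?gap_gt0//.
have l0 := lam_gt0 R (positive_flatten j cF).
apply: (@le_trans _ _ ((gap * (4 * lam R (flatten (mkseq c j)))) `^ s)).
  rewrite powRM ?mulr_ge0 ?(ltW l0) ?(ltW gap_gt0)// mulrC ler_pM2l ?powR_gt0 ?gap_gt0//.
  exact: mass_le (all_block_seq j cF).
apply: ge0_ler_powR; rewrite ?nnegrE ?mulr_ge0 ?(ltW gap_gt0) ?(ltW l0) ?(ltW s_gt0)//.
exact: (concat_blocks_separated cF c'F (agree _ c'F Uc')).
Qed.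

(** The mass distribution principle: a cover of total weight
    [gap `^ s / 4] would give cylinders that cover the tree and have total
    mass at most 1/2. *)
Lemma not_content_null_of_block_seqs (A : set R[i]) :
  (forall c, block_seq c -> A (cfr R (concat_blocks c))%:C%C) -> ~ content_null s A.
Proof.
move=> codeA nA; have g0 : 0 < gap `^ s by rewrite powR_gt0// gap_gt0.
have [|U AU Ue] := nA (gap `^ s / 4); first by rewrite divr_gt0.
have e2 k : 0 < 4^-1 / (2 ^ k.+1)%:R :> R by rewrite divr_gt0// ltr0n expn_gt0.
have /choice[v vP] i := node (U i) (e2 i).
have : (1 <= \sum_(0 <= i <oo) (mass weight (v i))%:E)%E.
  apply: (cylinder_cover_mass uniqF weight_ge0 sum_weight) => c cF.
  by have [i _ Ui] := AU _ (codeA c cF); exists i; apply: (vP i).1.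
rewrite leNgt => /negP; apply.
apply: (@le_lt_trans _ _ (4^-1 + 4^-1)%:E); last by rewrite lte_fin; lra.
apply: (@le_trans _ _ (\sum_(0 <= i <oo)
    (((gap `^ s)^-1)%:E * diam_pow s (U i) + (4^-1 / (2 ^ i.+1)%:R)%:E))%E).
  apply: lee_nneseries => [i _ _|i _]; first by rewrite lee_fin mass_ge0.
  exact: (vP i).2.
have d0 i : (0 <= ((gap `^ s)^-1)%:E * diam_pow s (U i))%E.
  by rewrite mule_ge0 ?diam_pow_ge0// lee_fin invr_ge0 powR_ge0.
apply: le_trans (epsilon_trick _ d0 _) _; first by rewrite invr_ge0.
rewrite EFinD leeD2r// nneseriesZl; last by move=> *; exact: diam_pow_ge0.
apply: (@le_trans _ _ (((gap `^ s)^-1)%:E * (gap `^ s / 4)%:E)%E).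
  by rewrite lee_pmul2l ?lte_fin ?invr_gt0.
by rewrite -EFinM lee_fin mulrA mulVf ?mul1r// gt_eqF.
Qed.

End Blocks.

(** * Sums over words of a given length *)

Section Words.
Variable R : realType.

Fixpoint words (N n : nat) : seq (seq nat) :=
  if n is m.+1 then [seq rcons u b | u <- words N m, b <- iota 1 N] else [:: [::]].

Lemma mem_words N n u :
  (u \in words N n) = [&& size u == n, positive u & all (fun a => a <= N)%N u].
Proof.
elim: n u => [|n IH] u; first by rewrite inE; case: u.
elim/last_ind: u => [|u b _].
  by apply/negbTE/allpairsPdep => -[v [a [_ _]]] /(congr1 size); rewrite size_rcons.
rewrite size_rcons eqSS /positive !all_rcons -!/(positive u).
transitivity ((u \in words N n) && (0 < b <= N)%N).
  apply/allpairsPdep/andP => [[v [a [vN]]]|[uN bN]].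
    by rewrite mem_iota => aN /rcons_inj[-> ->]; split=> //; lia.
  by exists u, b; rewrite mem_iota; split=> //; lia.
rewrite IH; case: (_ == _); case: (positive u) => //=;
  by case: (all _ u); rewrite ?andbT ?andbF// andbC.
Qed.

Lemma words_uniq N n : uniq (words N n).
Proof.
elim: n => [//|n IH] /=; apply: allpairs_uniq => //; first exact: iota_uniq.
by move=> [u a] [v b] _ _ /= /rcons_inj[-> ->].
Qed.

(** The length of the fundamental interval of [u], whose end points are
    [phi u 0] and [phi u 1]. *)
Definition fund_length u : R := `|phi u 1 - phi u 0|.

Lemma fund_length_le u : positive u -> fund_length u <= 4 * lam R u.
Proof.
move=> pu; apply: le_trans (phi_dist_le pu _ _) _; rewrite ?lexx ?ler01//.
by rewrite subr0 normr1 mulr1.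
Qed.

Lemma fund_length_ge u : positive u -> 2 * lam R u <= fund_length u.
Proof.
move=> pu; rewrite /fund_length phi_dist// subr0 normr1 mul1r.
have d0 := den_gt0 pu (lexx (0 : R)); have d1 := den_gt0 pu (ler01 : 0 <= 1 :> R).
have -> : 2 * lam R u = (2 * den u 0 * den u 0)^-1.
  by rewrite /lam; field; rewrite gt_eqF.
by rewrite lef_pV2 ?posrE ?mulr_gt0// ler_pM2r// den_1_le.
Qed.

(** The children with letters 1 to [N] fill the interval of [u] except for the
    part between [phi u 0] and [phi u N.+1%:R^-1], which bounded distortion
    shows to be short. *)
Lemma fund_length_children N u : positive u ->
  fund_length u * (1 - 2 / N.+1%:R) <= \sum_(b <- iota 1 N) fund_length (rcons u b).
Proof.
move=> pu; pose f b : R := phi u b%:R^-1.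
have -> : \sum_(b <- iota 1 N) fund_length (rcons u b) =
    \sum_(1 <= b < N.+1) `|f b.+1 - f b|.
  rewrite /index_iota subSS subn0; apply: eq_big_seq => b _.
  by rewrite /fund_length /f -cats1 !phi_cat/= addr0 natr1.
(* The intervals of the children are adjacent, so their lengths telescope. *)
have h1 : `|f N.+1 - f 1%N| <= \sum_(1 <= b < N.+1) `|f b.+1 - f b|.
  by rewrite -telescope_sumr//; exact: ler_norm_sum.
apply: le_trans h1; rewrite /f invr1.
have N1 : 0 <= (N.+1%:R^-1 : R) <= 1 by rewrite invr_ge0 ler0n invf_le1// ler1n.
have h2 : `|phi u N.+1%:R^-1 - phi u 0| <= 2 * N.+1%:R^-1 * fund_length u.
  apply: le_trans (phi_dist_le pu N1 _) _; first by rewrite lexx ler01.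
  rewrite subr0 ger0_norm; last by case/andP: N1.
  have := fund_length_ge pu => h.
  case/andP: N1 => N0 _; have := ler_wpM2l N0 h.
  by move: (_^-1) (lam R u) (fund_length u) => a b c; lra.
have h3 : fund_length u <= `|phi u N.+1%:R^-1 - phi u 1| + `|phi u N.+1%:R^-1 - phi u 0|.
  by rewrite [`|_ - phi u 1|]distrC; exact: ler_distD.
rewrite mulrBr mulr1 mulrC.
move: h2 h3; move: (N.+1%:R^-1) (fund_length u) => a b.
move: `|_ - phi u 0| `|_ - phi u 1| => c d; lra.
Qed.

Lemma sum_fund_length N n : (0 < N)%N ->
  (1 - 2 / N.+1%:R) ^+ n <= \sum_(u <- words N n) fund_length u.
Proof.
move=> N0; have r0 : 0 <= 1 - 2 / N.+1%:R :> R.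
  by rewrite subr_ge0 ler_pdivrMr// mul1r ler_nat.
elim: n => [|n IH]; first by rewrite big_seq1 /fund_length/= subr0 normr1.
rewrite /= big_allpairs_dep/= exprS mulrC.
apply: le_trans (ler_wpM2r r0 IH) _; rewrite mulr_suml big_seq [leRHS]big_seq.
apply: ler_sum => u; rewrite mem_words => /and3P[_ pu _].
exact: fund_length_children.
Qed.

Lemma bernoulli_inequality (x : R) n : 0 <= x <= 1 -> 1 - n%:R * x <= (1 - x) ^+ n.
Proof.
move=> /andP[x0 x1]; elim: n => [|n IH]; first by rewrite mul0r subr0.
rewrite exprS -natr1; have n0 : 0 <= n%:R :> R by [].
have : (1 - x) * (1 - n%:R * x) <= (1 - x) * (1 - x) ^+ n.
  by rewrite ler_wpM2l// subr_ge0.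
by apply: le_trans; nra.
Qed.

(** For [N] large, the lengths of the cylinders of the words of length [n] add up
    to at least 1/2, and each is at most [1 / n], so the sum of their powers of exponent [s < 1]
    is unbounded as [n] grows. *)
Lemma sum_lam_words (s : R) : 0 < s < 1 ->
  exists2 n, (0 < n)%N &
    exists2 N, (0 < N)%N & 1 <= \sum_(u <- words N n) lam R u `^ s.
Proof.
move=> /andP[s0 s1]; have s1' : 0 < 1 - s by rewrite subr_gt0.
have e8 : 0 < 8^-1 :> R by rewrite invr_gt0.
have [n n0 ne] := exists_pow_invn_le s1' e8.
(* With [N = 4 * n] the proportion lost at each of the [n] levels is at most
   [2 / (4 * n)], which leaves at least half of the total length. *)
exists n => //; exists (4 * n)%N; first by rewrite muln_gt0.
set N := (4 * n)%N.
have half : 2^-1 <= \sum_(u <- words N n) fund_length u.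
  have N0 : (0 < N)%N by rewrite muln_gt0.
  apply: le_trans (sum_fund_length n N0).
  apply: le_trans (bernoulli_inequality _ _).
    have : n%:R * (2 / N.+1%:R) <= 2^-1 :> R.
      rewrite mulrA ler_pdivrMr// -(natr1 N) /N natrM; lra.
    by move: (n%:R * _) => x; lra.
  by rewrite divr_ge0//= ler_pdivrMr// mul1r ler_nat /N; lia.
have le1 : \sum_(u <- words N n) fund_length u <=
    2^-1 * \sum_(u <- words N n) lam R u `^ s.
  rewrite mulr_sumr big_seq [leRHS]big_seq; apply: ler_sum => u.
  rewrite mem_words => /and3P[/eqP un pu _].
  apply: le_trans (fund_length_le pu) _; have l0 := lam_gt0 R pu.
  have l1 : lam R u `^ (1 - s) <= 8^-1.
    apply: le_trans ne; apply: le_trans (lam_powR_le (ltW s1') pu un n0).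
    by apply: ge0_ler_powR; rewrite ?nnegrE ?mulr_ge0 ?(ltW l0) ?(ltW s1')//; lra.
  have lE : lam R u = lam R u `^ s * lam R u `^ (1 - s).
    by rewrite -powRD addrC subrK ?powRr1 ?oner_eq0// ltW.
  have := ler_wpM2l (ltW (powR_gt0 s l0)) l1; rewrite -lE; lra.
lra.
Qed.

End Words.

(** * Words of bounded average *)

Section Sets.
Variable R : realType.
Implicit Types (alpha : R) (w : nat -> nat).

Lemma limn_esup_lt_near (f : nat -> R) (a : R) :
  (limn_esup (fun n => (f n)%:E) < a%:E)%E ->
  exists M, forall m, (M <= m)%N -> f m < a.
Proof.
move=> /ereal_inf_lt[_ [A [M _ MA] <-] supA]; exists M => m Mm.
rewrite -lte_fin; apply: le_lt_trans supA; apply: ereal_sup_ubound.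
by exists m => //; exact: MA.
Qed.

Lemma limn_esup_lt_of_near (f : nat -> R) (a b : R) M : b < a ->
  (forall m, (M <= m)%N -> f m <= b) ->
  (limn_esup (fun n => (f n)%:E) < a%:E)%E.
Proof.
move=> ba fb; apply: (@le_lt_trans _ _ b%:E); last by rewrite lte_fin.
apply: ge_ereal_inf; exists (ereal_sup [set (f n)%:E | n in [set n | (M <= n)%N]]).
  by exists [set n | (M <= n)%N] => //; exists M.
by apply: ge_ereal_sup => _ [m Mm <-]; rewrite lee_fin fb.
Qed.

Lemma X_set_itv alpha z : X_set alpha z -> exists2 x : R, 0 <= x <= 1 & z = x%:C%C.
Proof. by move=> [w [pw _] <-]; exists (cfr R w) => //; exact: cfr_itv. Qed.

Lemma content_null_unit_interval (s : R) (A : set R[i]) : 1 < s ->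
  (forall z, A z -> exists2 x : R, 0 <= x <= 1 & z = x%:C%C) -> content_null s A.
Proof.
move=> s1 Aitv; have s1' : 0 < s - 1 by rewrite subr_gt0.
apply: (@content_null_finite_cover _ _ _ _ (fun p : nat * nat => [set z |
  exists2 x : R, p.1%:R / p.2%:R <= x <= p.1.+1%:R / p.2%:R & z = x%:C%C])) => e e0.
have e2 : 0 < e / 2 by rewrite divr_gt0.
have [m m0 me] := exists_pow_invn_le s1' e2.
have mR : 0 < m%:R :> R by rewrite ltr0n.
exists [seq (k, m) | k <- iota 0 m.+1].
  move=> z /Aitv[x /andP[x0 x1] ->].
  have /truncn_itv/andP[k1 k2] : 0 <= x * m%:R by rewrite mulr_ge0// ltW.
  set k := Num.truncn (x * m%:R) in k1 k2.
  exists (k, m).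
    apply/map_f; rewrite mem_iota/= add0n ltnS -(ler_nat R); apply: le_trans k1 _.
    by rewrite ler_piMl// ltW.
  by exists x => //; rewrite ler_pdivrMr// k1 ler_pdivlMr// ltW.
rewrite big_map/=; apply: (@le_trans _ _ (\sum_(k <- iota 0 m.+1) (m%:R^-1 `^ s)%:E)%E).
  apply: lee_sum => k _; apply: diam_pow_le; rewrite ?invr_ge0//; first lra.
  move=> _ _ [x xk ->] [y yk ->]; rewrite cdist_real.
  have : k.+1%:R / m%:R = k%:R / m%:R + m%:R^-1 :> R by rewrite -natr1 mulrDl mul1r.
  by move: xk yk => /andP[? ?] /andP[? ?] ?; rewrite ler_norml; lra.
rewrite sumEFin lee_fin big_const_seq count_predT size_iota iter_addr_0.
have -> : s = 1 + (s - 1) by rewrite addrC subrK.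
rewrite powRD ?powRr1 ?invr_ge0//; last by rewrite addrC subrK gt_eqF//; lra.
apply: (@le_trans _ _ (m.+1%:R / m%:R * (e / 2))).
  rewrite -mulrnAl -[_^-1 *+ _]mulr_natl; apply: ler_wpM2l => //.
rewrite mulrAC ler_pdivrMr//.
have m2 : m.+1%:R <= 2 * m%:R :> R by rewrite -natrM ler_nat; lia.
apply: le_trans (ler_wpM2r (ltW e2) m2) _.
by rewrite mulrAC [2 * _]mulrC divfK.
Qed.

Definition ones_then k w : nat -> nat := fun i => if (i < k)%N then 1%N else w (i - k)%N.

Lemma cfr_ones_then k w : positive_word w ->
  cfr R (ones_then k w) = phi (nseq k 1%N) (cfr R w).
Proof.
move=> pw; have p1 : positive_word (ones_then k w).
  by move=> i; rewrite /ones_then; case: ifP.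
rewrite (cfr_phi R k p1); congr (phi _ (cfr R _)).
  apply: (@eq_from_nth _ 0%N); rewrite size_mkseq ?size_nseq// => i ik.
  by rewrite nth_mkseq// nth_nseq /ones_then ik.
by apply/funext => i; rewrite /tail_word /ones_then ltnNge leq_addr/= addKn.
Qed.

Lemma sum_ones_then k w n :
  (\sum_(i < n) ones_then k w i = minn n k + \sum_(i < n - k) w i)%N.
Proof.
elim: n => [|n IH]; first by rewrite sub0n !big_ord0 min0n.
rewrite big_ord_recr/= IH /ones_then; case: ltnP => nk.
  have -> : (n - k = 0)%N by lia.
  have -> : (n.+1 - k = 0)%N by lia.
  by rewrite !big_ord0; lia.
by rewrite subSn// big_ord_recr/=; lia.
Qed.

Lemma leq_sum_ord (w : nat -> nat) m n : (m <= n)%N ->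
  (\sum_(i < m) w i <= \sum_(i < n) w i)%N.
Proof.
move=> /subnKC <-; elim: (n - m)%N => [|k IH]; first by rewrite addn0.
by rewrite addnS big_ord_recr/= (leq_trans IH)// leq_addr.
Qed.

(** A letter 1 lowers the sum relative to [alpha] by [alpha - 1], so enough of
    them compensate for the finitely many prefixes whose average is not yet
    below [alpha]. *)
Lemma ones_then_T_words alpha w : 1 < alpha -> positive_word w ->
  (limn_esup (fun n => ((\sum_(i < n.+1) w i)%N%:R / n.+1%:R)%:E) < alpha%:E)%E ->
  exists k, T_words alpha (ones_then k w).
Proof.
move=> a1 pw /limn_esup_lt_near[M MP].
have a0 : 0 < alpha - 1 by rewrite subr_gt0.
have S0 : 0 <= (\sum_(i < M) w i)%N%:R / (alpha - 1) by rewrite divr_ge0// ltW.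
set k := (Num.truncn ((\sum_(i < M) w i)%N%:R / (alpha - 1))).+1.
have kS : (\sum_(i < M) w i)%N%:R < k%:R * (alpha - 1).
  by rewrite -ltr_pdivrMr// truncnS_gt.
exists k; split; first by move=> i; rewrite /ones_then; case: ifP.
move=> n n0; rewrite sum_ones_then; have nR : 0 < n%:R :> R by rewrite ltr0n.
have [nk|kn] := leqP n k.
  rewrite (_ : n - k = 0)%N; last by lia.
  by rewrite big_ord0 addn0 ltr_pMr.
have k0 : 0 < k%:R :> R by rewrite ltr0n.
have nE : n%:R = k%:R + (n - k)%:R :> R by rewrite -natrD subnKC// ltnW.
rewrite nE natrD.
set m := (n - k)%N; have m0 : (0 < m)%N by rewrite subn_gt0.
have mR : 0 < m%:R :> R by rewrite ltr0n.
have [Mm|mM] := leqP M m.-1.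
  have := MP _ Mm; rewrite prednK// ltr_pdivrMr// => h.
  have : k%:R < k%:R * alpha by rewrite ltr_pMr.
  lra.
have mM' : (m <= M)%N by lia.
have : (\sum_(i < m) w i)%N%:R <= (\sum_(i < M) w i)%N%:R :> R.
  by rewrite ler_nat leq_sum_ord.
have : 0 < m%:R * alpha by rewrite mulr_gt0//; lra.
lra.
Qed.

(** On the part of [X_set alpha] that needs [k] letters 1, the branch of
    [nseq k 1] maps into [piT alpha] and distorts distances by a bounded factor. *)
Lemma content_null_X_set alpha (s : R) : 1 < alpha -> 0 <= s ->
  content_null s (piT alpha) -> content_null s (X_set alpha).
Proof.
move=> a1 s0 nT.
pose g k (z : R[i]) : R[i] := (phi (nseq k 1%N) (complex.Re z))%:C%C.
have pone k : positive (nseq k 1%N) by rewrite /positive all_nseq orbT.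
apply: (@content_null_subset _ _ _ (\bigcup_k [set z | X_set alpha z /\ piT alpha (g k z)])).
  move=> z Xz; case: (Xz) => w [pw lw] zE.
  have [k Tk] := ones_then_T_words a1 pw lw; exists k => //=; split=> //.
  by exists (ones_then k w) => //; rewrite -zE /g /= -cfr_ones_then.
apply: content_null_bigcup => k.
have l0 := lam_gt0 R (pone k).
apply: (content_null_expanding (g := g k) (c := (lam R (nseq k 1%N))^-1) s0 _ _ _ nT).
- by rewrite invr_gt0.
- by move=> z [].
move=> z z' [/X_set_itv[x x01 ->] _] [/X_set_itv[y y01 ->] _].
by rewrite /g/= !cdist_real mulrC ler_pdivlMr// mulrC; exact: phi_dist_ge.
Qed.

Definition admissible alpha (u : seq nat) : bool :=
  all (fun j => (sumn (take j u))%:R < j%:R * alpha) (iota 1 (size u)).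

Lemma sumn_mkseq w n : sumn (mkseq w n) = (\sum_(i < n) w i)%N.
Proof.
elim: n => [|n IH]; first by rewrite big_ord0.
by rewrite mkseqS sumn_rcons IH big_ord_recr.
Qed.

(** An incomplete block contributes at most [b], so the average of the first
    [m] letters is at most [b / n + b / m]. *)
Lemma concat_blocks_X_set (F : seq (seq nat)) n N b alpha c :
  (0 < n)%N -> (forall u, u \in F -> size u = n) ->
  (forall u, u \in F -> positive u) ->
  (forall u, u \in F -> all (fun a => a <= N)%N u) ->
  (forall u, u \in F -> sumn u <= b)%N -> b%:R < n%:R * alpha ->
  block_seq F c -> X_set alpha (cfr R (concat_blocks n c))%:C%C.
Proof.
move=> n0 sF pF lF bF ba cF.
have nR : 0 < n%:R :> R by rewrite ltr0n.
exists (concat_blocks n c) => //; split; first exact: (concat_blocks_positive n0 sF pF lF).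
have blocks k : (\sum_(i < k * n) concat_blocks n c i <= k * b)%N.
  rewrite -sumn_mkseq (mkseq_concat_blocks n0 sF)//.
  elim: k => [//|k IH]; rewrite mkseqS -cats1 flatten_cat sumn_cat/= cats0.
  by rewrite mulSn addnC leq_add// bF.
have sums m : (\sum_(i < m) concat_blocks n c i)%N%:R <= m%:R * (b%:R / n%:R) + b%:R :> R.
  have h : (\sum_(i < m) concat_blocks n c i <= (m %/ n).+1 * b)%N.
    apply: leq_trans (blocks _); apply: leq_sum_ord.
    by rewrite ltnW// ltn_ceil.
  apply: (@le_trans _ _ ((m %/ n).+1 * b)%N%:R); first by rewrite ler_nat.
  rewrite natrM -natr1 mulrDl mul1r lerD2r mulrCA [leRHS]mulrC ler_wpM2r//.
  by rewrite ler_pdivlMr// -natrM ler_nat leq_trunc_div.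
pose d := (alpha - b%:R / n%:R) / 2.
have d0' : 0 < alpha - b%:R / n%:R by rewrite subr_gt0 ltr_pdivrMr// mulrC.
have d0 : 0 < d by rewrite divr_gt0.
pose M := Num.truncn (b%:R / d).
apply: (@limn_esup_lt_of_near _ alpha (b%:R / n%:R + d) M).
  by move: d0'; rewrite /d; move: (_ / n%:R) => x; lra.
move=> m Mm; rewrite ler_pdivrMr//; apply: le_trans (sums _) _.
rewrite mulrDl mulrC lerD2l mulrC -ler_pdivrMr//.
apply: ltW; apply: lt_le_trans (truncnS_gt _) _.
by rewrite ler_nat ltnS.
Qed.

(** The sums of the finitely many blocks have a maximum, which is still less
    than [n * alpha]; this provides the strict inequality in the definition of
    [X_set]. *)
Lemma not_content_null_X_set (F : seq (seq nat)) n N alpha (s : R) :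
  0 < alpha -> (0 < n)%N -> {subset F <= words N n} -> uniq F -> 0 < s ->
  (forall u, u \in F -> (sumn u)%:R < n%:R * alpha) ->
  1 <= \sum_(u <- F) lam R u `^ s -> ~ content_null s (X_set alpha).
Proof.
move=> a0 n0 Fw uF s0 Fa sum1.
have FP u : u \in F -> [&& size u == n, positive u & all (fun a => a <= N)%N u].
  by move=> /Fw; rewrite mem_words.
have sF u : u \in F -> size u = n by move=> /FP/and3P[/eqP].
have pF u : u \in F -> positive u by move=> /FP/and3P[].
have lF u : u \in F -> all (fun a => a <= N)%N u by move=> /FP/and3P[].
apply: (not_content_null_of_block_seqs n0 sF pF lF s0 uF sum1) => c cF.
pose b := \max_(u <- F) sumn u.
apply: (@concat_blocks_X_set F n N b) => //.
  by move=> u uF'; rewrite /b (big_rem u)//= leq_maxl.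
rewrite /b big_seq; elim/big_ind: _ => [|x y xl yl|u /Fa//].
  by rewrite mulr_gt0// ltr0n.
by case: leqP.
Qed.

Lemma admissible_mkseq alpha w n : T_words alpha w -> admissible alpha (mkseq w n).
Proof.
move=> [pw Tw]; apply/allP => j; rewrite mem_iota size_mkseq => /andP[j0].
rewrite add1n ltnS => jn; rewrite -(subnKC jn) mkseqD take_size_cat ?size_mkseq//.
by rewrite sumn_mkseq; exact: Tw.
Qed.

(** Cover by the cylinders of length [n]. Raising the exponent from [s] to [t]
    gains a factor [lam u `^ (t - s)], which tends to 0 uniformly in [u] as
    [n] grows. *)
Lemma piT_content_null alpha (s t : R) : 0 < alpha -> 0 <= s < t ->
  (forall n N, (0 < n)%N ->
    \sum_(u <- words N n | admissible alpha u) lam R u `^ s < 1) ->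
  content_null t (piT alpha).
Proof.
move=> a0 /andP[s0 st] sum_lt1; have st0 : 0 < t - s by rewrite subr_gt0.
have t0 := le_lt_trans s0 st.
apply: (@content_null_finite_cover _ _ _ _ (fun u => [set z |
  exists2 x : R, 0 <= x <= 1 & z = (phi u x)%:C%C])) => e e0.
have e4 : 0 < e / 4 `^ s by rewrite divr_gt0// powR_gt0.
have [n n0 ne] := exists_pow_invn_le st0 e4.
(* A letter of an admissible word of length [n] is at most the sum of the word,
   hence less than [n * alpha]. *)
pose N := (Num.truncn (n%:R * alpha)).+1.
exists [seq u <- words N n | admissible alpha u].
  move=> _ [w Tw <-]; have [pw Tw'] := Tw; exists (mkseq w n); last first.
    exists (cfr R (tail_word n w)); last by rewrite -cfr_phi.
    by rewrite cfr_itv//; exact: positive_tail.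
  rewrite mem_filter admissible_mkseq// mem_words size_mkseq eqxx positive_mkseq//=.
  apply/allP => _ /mapP[i + ->]; rewrite mem_iota => /andP[_ /= i_n].
  have : (w i <= \sum_(j < n) w j)%N by rewrite (bigD1 (Ordinal i_n))//= leq_addr.
  move=> /leq_trans; apply; rewrite -(ler_nat R) ltW//.
  by apply: lt_trans (Tw' n n0) _; exact: truncnS_gt.
rewrite big_filter.
apply: (@le_trans _ _ (\sum_(u <- words N n | admissible alpha u) (e * lam R u `^ s)%:E)%E).
  rewrite big_seq_cond [leRHS]big_seq_cond; apply: lee_sum => u.
  rewrite mem_words => /andP[/and3P[/eqP un pu _] _]; have l0 := lam_gt0 R pu.
  have l40 : 0 <= 4 * lam R u by rewrite mulr_ge0// ltW.
  apply: (@le_trans _ _ ((4 * lam R u) `^ t)%:E).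
    apply: diam_pow_le => //; first exact: ltW.
    move=> _ _ [x x01 ->] [y y01 ->]; rewrite cdist_real.
    apply: le_trans (phi_dist_le pu x01 y01) _; rewrite ler_piMr//.
    by move: x01 y01 => /andP[? ?] /andP[? ?]; rewrite ler_norml; lra.
  rewrite lee_fin (_ : t = s + (t - s)); last by rewrite addrC subrK.
  rewrite powRD; last by rewrite addrC subrK gt_eqF.
  rewrite powRM ?(ltW l0)// mulrAC ler_wpM2r ?powR_ge0//.
  have := le_trans (lam_powR_le (ltW st0) pu un n0) ne.
  by rewrite ler_pdivlMr ?powR_gt0// mulrC.
rewrite sumEFin lee_fin -mulr_sumr ler_piMr ?(ltW e0)//.
by apply: ltW; exact: sum_lt1.
Qed.

(** For the lower bound of the dimension of [X_set], the sum over the admissible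
    words of every length is less than 1 at each exponent for which [X_set] is
    null, since otherwise [not_content_null_X_set] applies. *)
Lemma hausdorff_dim_X_piT alpha : 1 < alpha ->
  hausdorff_dim (X_set alpha) = hausdorff_dim (piT alpha).
Proof.
move=> a1; have a0 : 0 < alpha by exact: lt_trans a1.
apply/eqP; rewrite eq_le; apply/andP; split; apply: hausdorff_dim_ge => s s0 nA.
  by apply: hausdorff_dim_le => //; exact: content_null_X_set nA.
apply/lee_addgt0Pr => e e0; rewrite -EFinD; apply: hausdorff_dim_le.
  by rewrite addr_ge0// ltW.
apply: (@piT_content_null _ (s + e / 2)) => //; first by apply/andP; split; lra.
move=> n N n0; rewrite ltNge; apply/negP => sum1.
apply: (@not_content_null_X_set [seq u <- words N n | admissible alpha u]
  n N alpha (s + e / 2)) => //.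
- by move=> u; rewrite mem_filter => /andP[].
- exact: filter_uniq (words_uniq _ _).
- by lra.
- move=> u; rewrite mem_filter mem_words => /andP[/allP adm /and3P[/eqP un _ _]].
  have := adm n; rewrite un mem_iota add1n ltnS leqnn n0 -un take_size; exact.
- by rewrite big_filter.
apply: content_null_mono nA => //; lra.
Qed.

Lemma hausdorff_dim_X_le1 alpha : (hausdorff_dim (X_set alpha) <= 1)%E.
Proof.
apply/lee_addgt0Pr => e e0; rewrite -EFinD; apply: hausdorff_dim_le; first by lra.
by apply: content_null_unit_interval; [lra|exact: X_set_itv].
Qed.

Lemma hausdorff_dim_X_near1 (s : R) : 0 < s < 1 ->
  exists N : nat, forall alpha, N%:R < alpha -> (s%:E <= hausdorff_dim (X_set alpha))%E.
Proof.
move=> s01; have [n n0 [N N0 sum1]] := sum_lam_words s01.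
exists N => alpha Na; apply: hausdorff_dim_ge_of_not_null.
have nR : 0 < n%:R :> R by rewrite ltr0n.
apply: (@not_content_null_X_set (words N n) n N) => //.
- exact: le_lt_trans Na.
- exact: words_uniq.
- by case/andP: s01.
move=> u; rewrite mem_words => /and3P[/eqP un _ uN].
apply: (@le_lt_trans _ _ (n%:R * N%:R)); last by rewrite ltr_pM2l.
rewrite -natrM ler_nat -un; elim: u uN {un} => [//|a u IH] /= /andP[aN /IH].
by rewrite mulSn; exact: leq_add.
Qed.

End Sets.

Theorem proposition5p2 (R : realType) :
  (forall alpha : R, 1 < alpha ->
     hausdorff_dim (X_set alpha) = hausdorff_dim (piT alpha)) /\
  hausdorff_dim (X_set alpha) @[alpha --> (+oo : set_system R)] --> (1%:E : \bar R).
Proof.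
split; first exact: hausdorff_dim_X_piT.
apply/fine_cvgP; split.
  have h : 0 < (2^-1 : R) < 1 by rewrite invr_gt0 ltr0n invf_lt1// ltr1n.
  have [N NP] := hausdorff_dim_X_near1 h.
  exists N%:R; split=> // alpha /NP ge_half.
  rewrite ge0_fin_numE; last by apply: le_trans ge_half; rewrite lee_fin; case/andP: h => /ltW.
  by apply: le_lt_trans (hausdorff_dim_X_le1 alpha) _; exact: ltry.
apply/cvgrPdist_le => e e0.
pose s := Num.max 2^-1 (1 - e).
have s01 : 0 < s < 1.
  rewrite lt_max gt_max invr_gt0 ltr0n invf_lt1// ltr1n/=; lra.
have [N NP] := hausdorff_dim_X_near1 s01.
exists N%:R; split=> // alpha /NP ge_s /=.
have le1 := hausdorff_dim_X_le1 alpha.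
have fin : hausdorff_dim (X_set alpha) \is a fin_num.
  rewrite ge0_fin_numE; first exact: le_lt_trans (ltry 1).
  by apply: le_trans ge_s; rewrite lee_fin; case/andP: s01 => /ltW.
have : s <= fine (hausdorff_dim (X_set alpha)) by rewrite -lee_fin fineK.
have : fine (hausdorff_dim (X_set alpha)) <= 1 by rewrite -lee_fin fineK.
rewrite /s ge_max => h1 /andP[_ h2]; rewrite ger0_norm; lra.
Qed.
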